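(* Let $k\geq 2$ be a constant and let $L$ be a regular language over the alphabet $\{0,1,\ldots,k-1\}$. Then a register machine with three registers can decide, in time linear in the number of $k$-ary digits of the input, whether the $k$-ary representation of a given input number belongs to $L$ (outputting $1$ if yes and $0$ if no). If $k$ is a power of two, two registers suffice.
   Context: Model (addition machine): a program is a finite list of numbered lines; the machine has finitely many registers, each holding an arbitrary integer. Allowed commands, each counting as one step: $x=y+z$, $x=y+c$, $x=y-z$, $x=y-c$, $x=c-y$, $x=c$ (registers $x,y,z$, integer constants $c$); ''read $x$''/''write $x$'' of a whole integer; conditionals ''if $x\,R\,y$'' and ''if $x\,R\,c$'' with $R\in\{<,=,>,\neq,\leq,\geq\}$; ''goto $\ell$''. Finitely many variables with a fixed finite range of values may also be used and do not count as registers. Running time is the number of executed commands. *)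

(* Defs.v *)
From HB Require Import structures.
From mathcomp Require Import all_boot all_order all_algebra.

Set Implicit Arguments.
Unset Strict Implicit.
Unset Printing Implicit Defensive.

Import Order.TTheory GRing.Theory Num.Theory.

Definition language (A : finType) := seq A -> Prop.

Record dfa (A : finType) := Dfa {
  dfa_state : finType;
  dfa_start : dfa_state;
  dfa_trans : dfa_state -> A -> dfa_state;
  dfa_final : {set dfa_state}
}.

Definition dfa_accepts (A : finType) (M : dfa A) (w : seq A) : bool :=
  foldl (@dfa_trans A M) (dfa_start M) w \in dfa_final M.

Definition regular (A : finType) (L : language A) : Prop :=
  exists M : dfa A, forall w : seq A, dfa_accepts M w <-> L w.

(** Words are written with the most significant digit first. *)
Definition kary_value (k : nat) (w : seq 'I_k) : nat :=
  foldl (fun (a : nat) (d : 'I_k) => a * k + d) 0 w.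

(** No leading zeros, except that the number 0 is represented by the
    one-digit word "0"; the empty word represents no number. *)
Definition kary_canonical (k : nat) (w : seq 'I_k) : bool :=
  if w is d :: w' then (w' == [::]) || (0 < d) else false.

Definition kary_rep (k n : nat) (w : seq 'I_k) : Prop :=
  kary_canonical w /\ kary_value w = n.

Lemma kary_value_rcons (k : nat) (w : seq 'I_k) (d : 'I_k) :
  kary_value (rcons w d) = kary_value w * k + d.
Proof. by rewrite /kary_value -cats1 foldl_cat. Qed.

Lemma kary_canonical_rcons (k : nat) (w : seq 'I_k) (d : 'I_k) :
  kary_canonical (rcons w d) =
  (w == [::]) || (kary_canonical w && (0 < kary_value w)).
Proof.
case: k w d => [w [] //|k [|a w] d //].
have -> : kary_canonical (rcons (a :: w) d) = (0 < a) by case: w.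
have pos (b : nat) (u : seq 'I_k.+1) :
  0 < b -> 0 < foldl (fun (c : nat) (e : 'I_k.+1) => c * k.+1 + e) b u.
  by elim: u b => //= e u IH b b0; apply: IH; rewrite addn_gt0 muln_gt0 b0.
rewrite /kary_value /=; case: (posnP a) => [a0|a0]; last first.
  by rewrite orbT pos.
by rewrite orbF; case: w => //=; rewrite a0.
Qed.

Lemma kary_rep_exists_unique (k n : nat) :
  2 <= k -> exists! w : seq 'I_k, kary_rep n w.
Proof.
move=> k2; have k0 : 0 < k by apply: leq_trans k2.
elim/ltn_ind: n => n IH.
have eqd (v : nat) (d : 'I_k) : (v * k + d) %/ k = v /\ (v * k + d) %% k = d.
  by rewrite divnMDl // modnMDl divn_small // modn_small // addn0.
have [nk|kn] := ltnP n k.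
  exists [:: Ordinal nk]; split; first by split.
  move=> w [cw vw]; case/lastP: w cw vw => // w d.
  rewrite kary_canonical_rcons kary_value_rcons => cw vw.
  have [qv rv] := eqd (kary_value w) d; rewrite vw in qv rv.
  have v0 : kary_value w = 0 by rewrite -qv divn_small.
  move: cw; rewrite v0 andbF orbF => /eqP ->; congr [:: _].
  by apply: val_inj; rewrite /= -rv modn_small.
have q0 : 0 < n %/ k by rewrite divn_gt0.
have [|w [[cw vw] uw]] := IH (n %/ k).
  by rewrite ltn_Pdiv // (leq_trans k0 kn).
exists (rcons w (Ordinal (ltn_pmod n k0))); split.
  split; first by rewrite kary_canonical_rcons cw vw q0 orbT.
  by rewrite kary_value_rcons vw /= -divn_eq.
move=> w2 [c2 v2]; case/lastP: w2 c2 v2 => // w2 d.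
rewrite kary_canonical_rcons kary_value_rcons => c2 v2.
have [qv rv] := eqd (kary_value w2) d; rewrite v2 in qv rv.
have w2n : w2 != [::].
  by apply: contraTneq q0 => w20; rewrite qv w20.
rewrite (negbTE w2n) /= in c2; case/andP: c2 => c2 _.
by rewrite (uw w2); [congr rcons; apply: val_inj; rewrite /= rv | split].
Qed.

Inductive relop := RLt | REq | RGt | RNe | RLe | RGe.

Definition rel_holds (R : relop) (a b : int) : bool :=
  match R with
  | RLt => (a < b)%R
  | REq => a == b
  | RGt => (a > b)%R
  | RNe => a != b
  | RLe => (a <= b)%R
  | RGe => (a >= b)%R
  end.

Definition fin_store (m s : nat) := {ffun 'I_m -> 'I_s.+1}.

(** [r] is the number of integer registers.  Besides them there are [m]
    variables whose values range over the finite set {0, ..., s}.  They never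
    exchange data with the registers except through the control flow: a
    variable is set by a finite table from the current values of the finite
    variables, and can be tested.  All conditionals are conditional jumps: the
    line [l] is next if the test succeeds, the following line otherwise. *)
Inductive command (r m s : nat) :=
  | AddReg of 'I_r & 'I_r & 'I_r                      (* x = y + z *)
  | AddCst of 'I_r & 'I_r & int                       (* x = y + c *)
  | SubReg of 'I_r & 'I_r & 'I_r                      (* x = y - z *)
  | SubCst of 'I_r & 'I_r & int                       (* x = y - c *)
  | CstSub of 'I_r & int & 'I_r                       (* x = c - y *)
  | SetCst of 'I_r & int                              (* x = c *)
  | Read of 'I_r
  | Write of 'I_r
  | IfReg of relop & 'I_r & 'I_r & nat                (* if x R y goto l *)
  | IfCst of relop & 'I_r & int & nat                 (* if x R c goto l *)
  | Goto of nat
  | FinSet of 'I_m & (fin_store m s -> 'I_s.+1)       (* v = f(v_0, v_1, ...) *)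
  | FinIf of (fin_store m s -> bool) & nat.           (* if p(v_0, v_1, ...) goto l *)

Arguments Goto {r m s}.

(** Lines are numbered from 0. *)
Record program (r : nat) := Program {
  fin_num : nat;
  fin_max : nat;
  code : seq (command r fin_num fin_max)
}.

Record config (r m s : nat) := Config {
  pc : nat;
  regs : {ffun 'I_r -> int};
  fins : fin_store m s;
  input : seq int;
  output : seq int
}.

Section Semantics.

Variables (r m s : nat).
Implicit Types (cf : config r m s) (x : 'I_r).

Definition jump cf (l : nat) : config r m s :=
  Config l (regs cf) (fins cf) (input cf) (output cf).

Definition next cf : config r m s := jump cf (pc cf).+1.

Definition set_reg cf x (a : int) : config r m s :=
  Config (pc cf) [ffun y => if y == x then a else regs cf y]
         (fins cf) (input cf) (output cf).

Definition set_fin cf (v : 'I_m) (a : 'I_s.+1) : config r m s :=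
  Config (pc cf) (regs cf) [ffun u => if u == v then a else fins cf u]
         (input cf) (output cf).

(** A [Read] on exhausted input blocks: there is no successor. *)
Definition exec (c : command r m s) cf : option (config r m s) :=
  match c with
  | AddReg x y z => Some (next (set_reg cf x (regs cf y + regs cf z)%R))
  | AddCst x y a => Some (next (set_reg cf x (regs cf y + a)%R))
  | SubReg x y z => Some (next (set_reg cf x (regs cf y - regs cf z)%R))
  | SubCst x y a => Some (next (set_reg cf x (regs cf y - a)%R))
  | CstSub x a y => Some (next (set_reg cf x (a - regs cf y)%R))
  | SetCst x a => Some (next (set_reg cf x a))
  | Read x =>
      if input cf is a :: inp then
        Some (next (set_reg (Config (pc cf) (regs cf) (fins cf) inp (output cf))
                            x a))
      else None
  | Write x =>
      Some (next (Config (pc cf) (regs cf) (fins cf) (input cf)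
                         (rcons (output cf) (regs cf x))))
  | IfReg R x y l =>
      Some (if rel_holds R (regs cf x) (regs cf y) then jump cf l else next cf)
  | IfCst R x a l =>
      Some (if rel_holds R (regs cf x) a then jump cf l else next cf)
  | Goto l => Some (jump cf l)
  | FinSet v f => Some (next (set_fin cf v (f (fins cf))))
  | FinIf p l => Some (if p (fins cf) then jump cf l else next cf)
  end.

End Semantics.

Definition config_of (r : nat) (P : program r) :=
  config r (fin_num P) (fin_max P).

(** The machine halts exactly when control leaves the list of lines. *)
Definition halted (r : nat) (P : program r) (cf : config_of P) : bool :=
  size (code P) <= pc cf.

Definition step (r : nat) (P : program r) (cf : config_of P) :
    option (config_of P) :=
  if halted cf then None else exec (nth (Goto 0) (code P) (pc cf)) cf.

Definition initial (r : nat) (P : program r) (inp : seq int) : config_of P :=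
  Config 0 [ffun=> 0%R] [ffun=> ord0] inp [::].

Definition run (r : nat) (P : program r) (inp : seq int) (t : nat) :
    option (config_of P) :=
  iter t (obind (@step r P)) (Some (initial P inp)).

Definition halts_within (r : nat) (P : program r) (inp : seq int) (T : nat)
    (out : seq int) : Prop :=
  exists t : nat, t <= T /\
  exists cf : config_of P, run P inp t = Some cf /\ halted cf /\ output cf = out.

(** Since every representation has at least one digit, the bound [C * size w]
    covers arbitrary affine bounds. *)
Definition decides_in_linear_time (r k : nat) (P : program r)
    (L : language 'I_k) : Prop :=
  exists C : nat, forall (n : nat) (w : seq 'I_k), kary_rep n w ->
    (L w -> halts_within P [:: Posz n] (C * size w) [:: Posz 1]) /\
    (~ L w -> halts_within P [:: Posz n] (C * size w) [:: Posz 0]).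

(* Main.v *)
(** With the input n in x, first set x := k n + 1, which appends a marker digit
    1, and y := k^2, and multiply y by k until y > x.  Then repeatedly replace x by
    k x and subtract y as often as possible: the number of subtractions is the
    next digit of n, most significant first, and is fed to the automaton.  The
    register x becomes 0 exactly when the marker has been consumed, so no
    counter is needed.  Multiplication of a register by k takes one auxiliary register
    in general, and none when k is a power of two. *)
Require Import Defs.
From mathcomp Require Import all_boot all_order all_algebra.
From mathcomp Require Import zify ring.

Set Implicit Arguments.
Unset Strict Implicit.
Unset Printing Implicit Defensive.

(** * Bounds on the value of a digit word *)

Lemma kary_value_cons k (d : 'I_k) w :
  kary_value (d :: w) = d * k ^ size w + kary_value w.
Proof.
elim/last_ind: w => [|w e IH]; first by rewrite /kary_value /=; lia.
by rewrite -rcons_cons !kary_value_rcons IH size_rcons expnSr; lia.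
Qed.

Lemma kary_value_lt k (w : seq 'I_k) : kary_value w < k ^ size w.
Proof.
elim/last_ind: w => [|w d IH] //.
by rewrite kary_value_rcons size_rcons expnSr; have := ltn_ord d; nia.
Qed.

Lemma kary_canonical_ge k (w : seq 'I_k) :
  kary_canonical w -> 1 < size w -> k ^ (size w).-1 <= kary_value w.
Proof.
case: w => [|d [|e w]] //= d0 _.
by rewrite kary_value_cons (leq_trans _ (leq_addr _ _)) // leq_pmull.
Qed.

(** * Reachability with step bounds, and code blocks *)

Section Reachability.

Variables (r : nat) (P : program r).
Implicit Types (A B D : config_of P -> Prop) (T : nat).

(** A total-correctness Hoare triple with a step bound. Bounding the number of steps, instead of
    fixing it, lets branches of different length share one statement. *)
Definition reach T A B := forall cf, A cf ->
  exists t cf',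
    [/\ t <= T, iter t (obind (@step r P)) (Some cf) = Some cf' & B cf'].

Lemma reach_trans T1 T2 T A B D :
  reach T1 A B -> reach T2 B D -> T1 + T2 <= T -> reach T A D.
Proof.
move=> rAB rBD leT cf /rAB [t1 [cf1 [le1 it1 /rBD [t2 [cf2 [le2 it2 Dcf2]]]]]].
exists (t2 + t1), cf2; split=> //; last by rewrite iterD it1.
by rewrite (leq_trans _ leT) // addnC leq_add.
Qed.

Definition block_at p (b : seq (command r (fin_num P) (fin_max P))) :=
  p + size b <= size (code P) /\
  forall i, i < size b -> nth (Goto 0) (code P) (p + i) = nth (Goto 0) b i.

Lemma block_at_code : block_at 0 (code P).
Proof. by []. Qed.

Lemma block_at_cat p b1 b2 :
  block_at p (b1 ++ b2) -> block_at p b1 /\ block_at (p + size b1) b2.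
Proof.
case; rewrite size_cat addnA => sz lk; split; split=> //.
- exact: leq_trans (leq_addr _ _) sz.
- by move=> i lti; rewrite lk ?nth_cat ?lti // ltn_addr.
- move=> i lti; rewrite -addnA lk ?ltn_add2l // nth_cat ltnNge leq_addr /=.
  by rewrite addKn.
Qed.

Lemma block_at_cons p c b :
  block_at p (c :: b) -> block_at p [:: c] /\ block_at p.+1 b.
Proof. by rewrite -cat1s => /block_at_cat; rewrite addn1. Qed.

Lemma step_block p c cf :
  block_at p [:: c] -> pc cf = p -> step cf = exec c cf.
Proof.
rewrite /block_at addn1 => -[ltp /(_ 0 isT)]; rewrite addn0 /= => cE pcE.
by rewrite /step /halted pcE leqNgt ltp /= cE.
Qed.

Lemma reach_step p c A B :
  block_at p [:: c] ->
  (forall cf, A cf -> pc cf = p /\ exists cf', exec c cf = Some cf' /\ B cf') ->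
  reach 1 A B.
Proof.
move=> bc AB cf /AB [pcE [cf' [ecf Bcf']]]; exists 1, cf'; split=> //=.
by rewrite (step_block bc pcE).
Qed.

End Reachability.

(** * Multiplication of a register by a constant through additions *)

Definition addition r := ('I_r * 'I_r * 'I_r)%type.

Definition add_command r m s (a : addition r) : command r m s :=
  AddReg m s a.1.1 a.1.2 a.2.

Definition do_add r (R : {ffun 'I_r -> int}) (a : addition r) :
    {ffun 'I_r -> int} :=
  [ffun y => if y == a.1.1 then (R a.1.2 + R a.2)%R else R y].

Lemma iter_step_adds r (P : program r) p (s : seq (addition r)) cf :
  block_at p [seq add_command (fin_num P) (fin_max P) a | a <- s] ->
  pc cf = p ->
  iter (size s) (obind (@step r P)) (Some cf) =
  Some (Config (p + size s) (foldl (@do_add r) (regs cf) s) (fins cf)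
               (input cf) (output cf)).
Proof.
elim: s p cf => [|a s IH] p cf.
  by case: cf => ? ? ? ? ? _ /= <-; rewrite addn0.
move=> /block_at_cons [ba bs] pcE; rewrite /= -iterS iterSr /=.
by rewrite (step_block ba pcE) /= (IH p.+1) //= ?pcE // addSnnS.
Qed.

(** Only [a] and the other working register [b] are constrained, so a scratch register may be
    overwritten freely. *)
Definition multiplies r (k : nat) (a b : 'I_r) (s : seq (addition r)) :=
  forall R, foldl (@do_add r) R s a = (k%:Z * R a)%R /\
            foldl (@do_add r) R s b = R b.

(** Each addition doubles [a] in place, hence no scratch register. *)
Lemma multiplies_pow2 r e (a b : 'I_r) :
  b != a -> multiplies (2 ^ e) a b (nseq e (a, a, a)).
Proof.
move=> neq; elim: e => [|e IH] R /=; first by rewrite expn0 GRing.mul1r.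
have [-> ->] := IH (do_add R (a, a, a)).
by rewrite !ffunE eqxx (negbTE neq) expnS PoszM; split=> //; ring.
Qed.

(** The first addition makes [t] equal to 2a whatever it held before, [k] further ones raise it to
    (k+2)a, and the final [a = t + a] gives (k+3)a. *)
Lemma multiplies_temp r k (a b t : 'I_r) :
  b != a -> a != t -> b != t ->
  multiplies k.+3 a b ((t, a, a) :: rcons (nseq k (t, t, a)) (a, t, a)).
Proof.
move=> ba at_ bt R; rewrite /= -cats1 foldl_cat /=.
set R1 := do_add R _.
have [Ra Rb Rt] : [/\ R1 a = R a, R1 b = R b & R1 t = (2%:Z * R a)%R].
  by rewrite !ffunE /= eqxx (negbTE at_) (negbTE bt); split=> //; lia.
have loop j : forall S, let S' := foldl (@do_add r) S (nseq j (t, t, a)) in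
    [/\ S' a = S a, S' b = S b & S' t = (S t + j%:Z * S a)%R].
  elim: j => [|j IH] S /=; first by split=> //; lia.
  have [-> -> ->] := IH (do_add S (t, t, a)).
  by rewrite !ffunE /= eqxx (negbTE at_) (negbTE bt); split=> //; lia.
have [ea eb et] := loop k R1.
by rewrite !ffunE /= eqxx (negbTE ba) ea eb et Ra Rb Rt; split=> //; lia.
Qed.

(** * Code of the machine and its line numbers *)

Section Machine.

(* The base is [k.+2], so that ['I_base] has a canonical zero; one finite
   variable encodes the state of [M] and the number of subtractions of [ry]. *)
Variables (r k : nat) (M : dfa 'I_k.+2) (rx ry : 'I_r).
Variables (mx my : seq (addition r)).
Hypothesis neq_yx : ry != rx.
Hypothesis mxP : multiplies k.+2 rx ry mx.
Hypothesis myP : multiplies k.+2 ry rx my.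

Notation base := k.+2.
Notation mem := (dfa_state M * 'I_base)%type.
Notation smax := #|{: mem}|.
Notation store := (fin_store 1 smax).

Definition mem_start : mem := (dfa_start M, ord0).

(** The variable has one value more than [mem] has elements; that value decodes to the default
    [mem_start]. *)
Definition decode (f : store) : mem := nth mem_start (enum {: mem}) (f ord0).

Definition encode (x : mem) : 'I_smax.+1 := inord (enum_rank x).

Definition update (g : mem -> mem) : command r 1 smax :=
  Defs.FinSet r ord0 (fun f : store => encode (g (decode f))).

Lemma decode_encode (f : store) x : f ord0 = encode x -> decode f = x.
Proof.
rewrite /decode /encode => ->; rewrite inordK; last by rewrite ltnS ltnW.
by rewrite nth_enum_rank.
Qed.

Notation lx := (size mx).
Notation ly := (size my).
Notation adds := (map (@add_command r 1 smax)).

(** This is the line of the comparison, after three initial commands, [mx] and the marker increment.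
    The 2 in [digit_pc] counts that comparison and the closing [Goto]. *)
Definition grow_pc := 4 + lx.
Definition digit_pc := grow_pc + ly + 2.
Definition sub_pc := digit_pc + lx.

(** The final y is [base] to the number of digits plus one, which is already [base * base] for
    one-digit inputs. The zero store need not decode to [mem_start], hence the [update]. *)
Definition init_code : seq (command r 1 smax) :=
  [:: Read 1 smax rx;
      SetCst 1 smax ry (base * base)%:Z;
      update (fun=> mem_start)].

Definition grow_code : seq (command r 1 smax) :=
  [:: AddCst 1 smax rx rx (Posz 1);
      IfReg 1 smax RLt rx ry digit_pc].

Definition sub_code : seq (command r 1 smax) :=
  [:: IfReg 1 smax RLt rx ry sub_pc.+4;
      SubReg 1 smax rx rx ry;
      update (fun x => (x.1, inord x.2.+1));
      Goto sub_pc;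
      IfCst 1 smax REq rx (Posz 0) (sub_pc.+4).+3;
      update (fun x => (dfa_trans x.1 x.2, ord0));
      Goto digit_pc;
      SetCst 1 smax rx (Posz 0);
      FinIf r (fun f : store => (decode f).1 \notin dfa_final M)
        (sub_pc.+4).+4.+2;
      SetCst 1 smax rx (Posz 1);
      Write 1 smax rx].

Definition machine_code : seq (command r 1 smax) :=
  init_code ++ adds mx ++ grow_code ++ adds my ++ [:: Goto grow_pc]
  ++ adds mx ++ sub_code.

Definition machine : program r := Program machine_code.

(** Registers other than [rx] and [ry] are left free, which accommodates the scratch register. *)
Definition at_ p (X Y : nat) (x : mem) inp out (cf : config_of machine) :=
  [/\ pc cf = p, regs cf rx = Posz X, regs cf ry = Posz Y, decode (fins cf) = x
    & (input cf, output cf) = (inp, out)].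

(** * Effect of the multiplication blocks and of single commands *)

Lemma reach_mx p X Y x inp out :
  @block_at r machine p (adds mx) ->
  reach lx (at_ p X Y x inp out) (at_ (p + lx) (base * X) Y x inp out).
Proof.
move=> bl cf [pcE xE yE fE ioE]; exists lx; eexists; split=> //.
  exact: iter_step_adds bl pcE.
by have [ex ey] := mxP (regs cf); split=> //=; rewrite ?ex ?ey ?xE.
Qed.

Lemma reach_my p X Y x inp out :
  @block_at r machine p (adds my) ->
  reach ly (at_ p X Y x inp out) (at_ (p + ly) X (base * Y) x inp out).
Proof.
move=> bl cf [pcE xE yE fE ioE]; exists ly; eexists; split=> //.
  exact: iter_step_adds bl pcE.
by have [ex ey] := myP (regs cf); split=> //=; rewrite ?ex ?ey ?yE.
Qed.

Lemma reach_update p g X Y x inp out :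
  @block_at r machine p [:: update g] ->
  reach 1 (at_ p X Y x inp out) (at_ p.+1 X Y (g x) inp out).
Proof.
move=> bl; apply: (reach_step bl) => cf [pcE xE yE fE ioE]; split=> //.
eexists; split; first by [].
split=> //=; first by rewrite pcE.
by apply: decode_encode; rewrite ffunE /= fE.
Qed.

Lemma reach_goto p l X Y x inp out :
  @block_at r machine p [:: Goto l] ->
  reach 1 (at_ p X Y x inp out) (at_ l X Y x inp out).
Proof.
move=> bl; apply: (reach_step bl) => cf [pcE xE yE fE ioE]; split=> //.
by eexists; split.
Qed.

Lemma reach_if_lt p l X Y x inp out :
  @block_at r machine p [:: IfReg 1 smax RLt rx ry l] ->
  reach 1 (at_ p X Y x inp out)
          (at_ (if X < Y then l else p.+1) X Y x inp out).
Proof.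
move=> bl; apply: (reach_step bl) => cf [pcE xE yE fE ioE]; split=> //.
eexists; split; first by [].
by rewrite /= xE yE ltz_nat; case: ltnP; split=> //=; rewrite pcE.
Qed.

Lemma reach_if_eq0 p l X Y x inp out :
  @block_at r machine p [:: IfCst 1 smax REq rx (Posz 0) l] ->
  reach 1 (at_ p X Y x inp out)
          (at_ (if X == 0 then l else p.+1) X Y x inp out).
Proof.
move=> bl; apply: (reach_step bl) => cf [pcE xE yE fE ioE]; split=> //.
eexists; split; first by [].
by rewrite /= xE eqz_nat; case: eqP; split=> //=; rewrite pcE.
Qed.

Lemma reach_set_x p c X Y x inp out :
  @block_at r machine p [:: SetCst 1 smax rx (Posz c)] ->
  reach 1 (at_ p X Y x inp out) (at_ p.+1 c Y x inp out).
Proof.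
move=> bl; apply: (reach_step bl) => cf [pcE xE yE fE ioE]; split=> //.
eexists; split; first by [].
by split=> //=; rewrite ?ffunE ?eqxx ?(negbTE neq_yx) ?pcE.
Qed.

Lemma reach_sub p X Y x inp out :
  @block_at r machine p [:: SubReg 1 smax rx rx ry] ->
  reach 1 (at_ p (Y + X) Y x inp out) (at_ p.+1 X Y x inp out).
Proof.
move=> bl; apply: (reach_step bl) => cf [pcE xE yE fE ioE]; split=> //.
eexists; split; first by [].
split=> //=; rewrite ?ffunE ?eqxx ?(negbTE neq_yx) ?pcE // xE yE; lia.
Qed.

(** * Phases of the run: growth of y, digit extraction, output *)

Lemma machine_blocks :
  [/\ @block_at r machine 0 init_code,
      @block_at r machine 3 (adds mx),
      @block_at r machine (3 + lx) grow_code,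
      @block_at r machine grow_pc.+1 (adds my)
    & [/\ @block_at r machine (grow_pc.+1 + ly) [:: Goto grow_pc],
          @block_at r machine digit_pc (adds mx)
        & @block_at r machine sub_pc sub_code]].
Proof.
have [b0 /block_at_cat [b1 /block_at_cat [b2 /block_at_cat [b3
  /block_at_cat [b4 /block_at_cat [b5 b6]]]]]] :=
  block_at_cat (block_at_code machine).
rewrite !size_map /= in b1 b2 b3 b4 b5 b6.
have e1 : 0 + 3 + lx + 2 = grow_pc.+1 by rewrite /grow_pc; lia.
have e2 : grow_pc.+1 + ly + 1 = digit_pc by rewrite /digit_pc; lia.
by rewrite e1 in b3 b4 b5 b6; rewrite e2 in b5 b6.
Qed.

(** Here [j] counts the multiplications still due. The upper bound on [X] makes the last comparison
    leave the loop, the lower bound makes all earlier ones stay; for [j = 0] there are no earlier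
    ones, hence the guard. *)
Lemma reach_grow j i X q inp out :
  X < base ^ (i + j) -> (0 < j -> base ^ (i + j).-1 <= X) ->
  reach (j * (ly + 2) + 1)
    (at_ grow_pc X (base ^ i) q inp out)
    (at_ digit_pc X (base ^ (i + j)) q inp out).
Proof.
have [_ _ /block_at_cons [_]] := machine_blocks.
rewrite -[(3 + lx).+1]/(grow_pc) => bif bmy [bgo _ _].
elim: j i => [|j IH] i ltX geX.
  have := @reach_if_lt _ _ X (base ^ i) q inp out bif.
  by rewrite addn0 in ltX *; rewrite ltX.
have r1 := @reach_if_lt _ _ X (base ^ i) q inp out bif.
have geXi : base ^ i <= X.
  by rewrite (leq_trans _ (geX isT)) // leq_pexp2l //; lia.
rewrite ltnNge geXi /= in r1.
have r2 := @reach_my _ X (base ^ i) q inp out bmy.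
have r3 := @reach_goto _ _ X (base * base ^ i) q inp out bgo.
rewrite -expnS in r2 r3; rewrite addnS -addSn in ltX geX *.
have r4 := IH i.+1 ltX (fun _ => geX isT).
apply: (reach_trans r1 (reach_trans r2 (reach_trans r3 r4 (leqnn _))
  (leqnn _))).
lia.
Qed.

(** Division of x by y by repeated subtraction, by induction on the quotient [d]; [c + d < base]
    keeps the counter from overflowing. *)
Lemma reach_sub_loop d c X Y q inp out :
  X < Y -> c + d < base ->
  reach (4 * d + 1)
    (at_ sub_pc (d * Y + X) Y (q, inord c) inp out)
    (at_ sub_pc.+4 X Y (q, inord (c + d)) inp out).
Proof.
have [_ _ _ _ [_ _ /block_at_cons [b0 /block_at_cons [b1 /block_at_cons [b2
  /block_at_cons [b3 _]]]]]] := machine_blocks.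
move=> ltXY; elim: d c => [|d IH] c ltc.
  have := @reach_if_lt _ _ X Y (q, inord c) inp out b0.
  by rewrite ltXY addn0 mul0n muln0.
have r1 := @reach_if_lt _ _ (d.+1 * Y + X) Y (q, inord c) inp out b0.
rewrite mulSn -addnA ltnNge leq_addr /= in r1 *.
have r2 := @reach_sub _ (d * Y + X) Y (q, inord c) inp out b1.
have r3 := @reach_update _ _ (d * Y + X) Y (q, inord c) inp out b2.
have r4 := @reach_goto _ _ (d * Y + X) Y (q, inord c.+1) inp out b3.
rewrite /= inordK in r3; last by lia.
have ltc1 : c.+1 + d < base by lia.
have r5 := IH c.+1 ltc1; rewrite addSnnS in r5.
apply: (reach_trans r1 (reach_trans r2 (reach_trans r3
          (reach_trans r4 r5 (leqnn _)) (leqnn _)) (leqnn _))).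
lia.
Qed.

(** One round: the digit is the quotient of [base * X] by [Y]. Remainder 0 means that the marker is
    spent, and control goes to the output instead of the automaton. *)
Lemma reach_extract d X Y q inp out R :
  base * X = d * Y + R -> R < Y -> d < base ->
  reach (lx + 4 * d + 2)
    (at_ digit_pc X Y (q, ord0) inp out)
    (at_ (if R == 0 then (sub_pc.+4).+3 else (sub_pc.+4).+1) R Y (q, inord d)
         inp out).
Proof.
move=> eX ltR ltd.
have [_ _ _ _ [_ bmx /block_at_cons [_ /block_at_cons [_ /block_at_cons [_
  /block_at_cons [_ /block_at_cons [b4 _]]]]]]] := machine_blocks.
have r1 := @reach_mx _ X Y (q, ord0) inp out bmx.
rewrite eX in r1.
have r2 := reach_sub_loop (q := q) (inp := inp) (out := out)
  ltR (ltd : 0 + d < base).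
have e0 : inord 0 = ord0 :> 'I_base by apply: val_inj; rewrite /= inordK.
rewrite e0 add0n in r2.
have r3 := @reach_if_eq0 _ _ R Y (q, inord d) inp out b4.
apply: (reach_trans r1 (reach_trans r2 r3 (leqnn _))); lia.
Qed.

(** Invariant with [i] digits consumed and [w] left; y never changes because [size w + i] is
    constant. A round with digit d takes at most lx + 4d + 4 steps, and the marker adds one round to
    those of [w]. *)
Lemma reach_digits w i Y q inp out : Y = base ^ (size w + i).+1 ->
  reach ((lx + 4 * base) * (size w).+1)
    (at_ digit_pc ((kary_value w * base + 1) * base ^ i) Y (q, ord0) inp out)
    (at_ (sub_pc.+4).+3 0 Y (foldl (@dfa_trans _ M) q w, inord 1) inp out).
Proof.
have [_ _ _ _ [_ _ /block_at_cons [_ /block_at_cons [_ /block_at_cons [_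
  /block_at_cons [_ /block_at_cons [_ /block_at_cons [b5 /block_at_cons [b6 _
  ]]]]]]]]] := machine_blocks.
elim: w i q => [|d w IH] i q eY.
  (* Only the marker is left: x is [base ^ i], so after scaling a single subtraction leaves 0, and
     this digit 1 is not fed to the automaton. *)
  rewrite {}eY => cf Acf; have [||||t [cf' [le it B]]] := 
    @reach_extract 1 (base ^ i) (base ^ i.+1) q inp out 0 _ _ _ cf.
  - by rewrite mul1n addn0 expnS.
  - by rewrite expn_gt0.
  - by [].
  - by move: Acf; rewrite /kary_value /= mul0n add0n mul1n.
  by exists t, cf'; split=> //; rewrite (leq_trans le) //=; lia.
set R := (kary_value w * base + 1) * base ^ i.+1.
have eX : base * ((kary_value (d :: w) * base + 1) * base ^ i) = d * Y + R.
  rewrite kary_value_cons eY /R /= addSn !expnS expnD; ring.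
(* The marker below the digits keeps the remainder nonzero even if all of [w] is zero. *)
have R0 : R != 0 by rewrite /R muln_eq0 addn1 expn_eq0.
(* Since [kary_value w] is at most [base ^ size w - 1] and [base] is at least 2, appending the
   marker stays below [base ^ (size w).+1]. *)
have ltR : R < Y.
  rewrite /R eY /= addSn -addnS -addSn expnD ltn_pmul2r ?expn_gt0 // expnS.
  by have := kary_value_lt w; nia.
have r1 := reach_extract (q := q) (inp := inp) (out := out) eX ltR (ltn_ord d).
rewrite (negbTE R0) inord_val in r1.
have r2 := @reach_update _ _ R Y (q, d) inp out b5.
have r3 := @reach_goto _ _ R Y (dfa_trans q d, ord0) inp out b6.
have eY' : Y = base ^ (size w + i.+1).+1 by rewrite addnS.
have r4 := IH i.+1 (dfa_trans q d) eY'.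
apply: (reach_trans r1 (reach_trans r2 (reach_trans r3 r4 (leqnn _))
  (leqnn _))).
by have := ltn_ord d; rewrite /=; lia.
Qed.

Definition halted_with out (cf : config_of machine) :=
  halted cf /\ output cf = out.

Lemma reach_output X Y q c inp :
  reach 4
    (at_ (sub_pc.+4).+3 X Y (q, c) inp [::])
    (halted_with [:: Posz (q \in dfa_final M)]).
Proof.
have [_ _ _ _ [_ _ /block_at_cons [_ /block_at_cons [_ /block_at_cons [_
  /block_at_cons [_ /block_at_cons [_ /block_at_cons [_ /block_at_cons [_
  /block_at_cons [b7 /block_at_cons [b8 /block_at_cons [b9 b10]]]]]]]]]]]] :=
  machine_blocks.
have r1 := @reach_set_x _ _ X Y (q, c) inp [::] b7.
have r2 : reach 1 (at_ (sub_pc.+4).+4 0 Y (q, c) inp [::])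
    (at_ (if q \notin dfa_final M then (sub_pc.+4).+4.+2 else (sub_pc.+4).+4.+1)
       0 Y (q, c) inp [::]).
  apply: (reach_step b8) => cf [pcE xE yE fE ioE]; split=> //.
  eexists; split; first by [].
  by rewrite fE /=; case: ifP; split=> //=; rewrite pcE.
have r4 Z : reach 1 (at_ (sub_pc.+4).+4.+2 Z Y (q, c) inp [::])
    (halted_with [:: Posz Z]).
  apply: (reach_step b10) => cf [pcE xE yE fE [_ oE]]; split=> //.
  eexists; split; first by [].
  split; last by rewrite /= oE xE.
  rewrite /halted /= pcE /sub_pc /digit_pc /grow_pc.
  by do !rewrite ?(size_cat, size_map) /=; lia.
case: (q \in dfa_final M) r2 => /= r2; last first.
  by apply: (reach_trans r1 (reach_trans r2 (r4 0) (leqnn _))).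
have r3 := @reach_set_x _ 1 0 Y (q, c) inp [::] b9.
by apply: (reach_trans r1 (reach_trans r2 (reach_trans r3 (r4 1) (leqnn _))
  (leqnn _))).
Qed.

(** * Initialisation and total running time *)

Lemma reach_start n :
  reach (5 + lx) (fun cf => cf = initial machine [:: Posz n])
    (at_ grow_pc (base * n + 1) (base ^ 2) mem_start [::] [::]).
Proof.
have [/block_at_cons [b0 /block_at_cons [b1 b2]] bmx] := machine_blocks.
move=> /block_at_cons [b3 _] _ _.
(* [at_] also fixes y and the decoded store, which are set only by the next two commands. *)
pose loaded (cf : config_of machine) := [/\ pc cf = 1, regs cf rx = Posz n &
  (input cf, output cf) = ([::], [::])].
have r0 : reach 1 (fun cf => cf = initial machine [:: Posz n]) loaded.
  apply: (reach_step b0) => cf ->; split=> //; eexists; split; first by [].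
  by split=> //=; rewrite ffunE eqxx.
pose sized (cf : config_of machine) := [/\ pc cf = 2, regs cf rx = Posz n,
  regs cf ry = Posz (base ^ 2) & (input cf, output cf) = ([::], [::])].
have r1 : reach 1 loaded sized.
  apply: (reach_step b1) => cf [pcE xE ioE]; split=> //.
  eexists; split; first by [].
  by split=> //=; rewrite ?pcE // ffunE ?eqxx // eq_sym (negbTE neq_yx).
have r2 : reach 1 sized (at_ 3 n (base ^ 2) mem_start [::] [::]).
  apply: (reach_step b2) => cf [pcE xE yE ioE]; split=> //.
  eexists; split; first by [].
  by split=> //=; [rewrite pcE | apply: decode_encode; rewrite ffunE].
have r3 := @reach_mx _ n (base ^ 2) mem_start [::] [::] bmx.
have r4 : reach 1 (at_ (3 + lx) (base * n) (base ^ 2) mem_start [::] [::])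
    (at_ grow_pc (base * n + 1) (base ^ 2) mem_start [::] [::]).
  apply: (reach_step b3) => cf [pcE xE yE fE ioE]; split=> //.
  eexists; split; first by [].
  by split=> //=; rewrite ?pcE // ffunE ?eqxx ?(negbTE neq_yx) // xE.
apply: (reach_trans r0 (reach_trans r1 (reach_trans r2
  (reach_trans r3 r4 (leqnn _)) (leqnn _)) (leqnn _))).
lia.
Qed.

Lemma machine_halts w n : kary_rep n w ->
  halts_within machine [:: Posz n] ((20 + 3 * lx + ly + 8 * base) * size w)
    [:: Posz (dfa_accepts M w)].
Proof.
move=> [cw vw].
have w0 : 0 < size w by case: w cw {vw}.
(* y starts at [base ^ 2] and must reach [base ^ (2 + m)], so [m] multiplications are due. *)
pose m := (size w).-1; have szw : size w = m.+1 by rewrite prednK.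
have r0 := @reach_start n.
have ltX : base * n + 1 < base ^ (2 + m).
  by have := kary_value_lt w; rewrite vw szw !expnS; nia.
have geX : 0 < m -> base ^ (2 + m).-1 <= base * n + 1.
  move=> m0; have := kary_canonical_ge cw; rewrite vw szw ltnS m0 => /(_ isT).
  by rewrite /= expnS; nia.
have r1 := reach_grow (q := mem_start) (inp := [::]) (out := [::]) ltX geX.
have eY : base ^ (2 + m) = base ^ (size w + 0).+1 by rewrite addn0 szw.
have r2 := reach_digits (q := dfa_start M) (inp := [::]) (out := [::]) eY.
rewrite vw expn0 muln1 (mulnC n) in r2.
have r3 := @reach_output 0 (base ^ (2 + m))
  (foldl (@dfa_trans _ M) (dfa_start M) w)
  (inord 1) [::].
have r4 : reach ((20 + 3 * lx + ly + 8 * base) * size w)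
    (fun cf => cf = initial machine [:: Posz n])
    (halted_with [:: Posz (dfa_accepts M w)]).
  apply: (reach_trans r0 (reach_trans r1 (reach_trans r2 r3 (leqnn _))
    (leqnn _))).
  (* The digit phase has [(size w).+1 <= 2 * size w] rounds, which doubles its cost per digit; the
     20 absorbs the additive constants. *)
  by rewrite szw; nia.
have [t [cf [let_ it [hcf ocf]]]] := r4 _ erefl.
by exists t; split=> //; exists cf.
Qed.

Lemma machine_decides (L : language 'I_base) :
  (forall w, dfa_accepts M w <-> L w) -> decides_in_linear_time machine L.
Proof.
move=> ML; exists (20 + 3 * lx + ly + 8 * base) => n w rw.
have := machine_halts rw; case: (boolP (dfa_accepts M w)) => acc hw.
  by split=> // nLw; case: nLw; apply/ML.
by split=> // /ML Lw; rewrite Lw in acc.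
Qed.

End Machine.

(** * Choice of registers and multiplication blocks *)

Theorem theorem13 (k : nat) (hk : 2 <= k) (L : language 'I_k) (hL : regular L) :
  (exists P : program 3, decides_in_linear_time P L) /\
  ((exists e : nat, k = 2 ^ e) ->
   exists P : program 2, decides_in_linear_time P L).
Proof.
case: k hk L hL => [|[|k]] // _ L [M ML]; split; last first.
  move=> [e ke]; pose rx : 'I_2 := ord0; pose ry : 'I_2 := lift ord0 ord0.
  exists (machine M rx ry (nseq e (rx, rx, rx)) (nseq e (ry, ry, ry))).
  by apply: machine_decides => //; rewrite ke; apply: multiplies_pow2.
pose rx : 'I_3 := inord 0; pose ry : 'I_3 := inord 1; pose rt : 'I_3 := inord 2.
have neq (i j : nat) : i < 3 -> j < 3 -> i != j -> inord i != inord j :> 'I_3.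
  by move=> i3 j3; rewrite -val_eqE /= !inordK.
(* [multiplies_temp] covers the bases from 3 on; base 2 needs a single doubling. *)
case: k => [|k] in L M ML *.
  exists (machine M rx ry (nseq 1 (rx, rx, rx)) (nseq 1 (ry, ry, ry))).
  apply: machine_decides => //; [exact: neq | |];
    exact: (@multiplies_pow2 3 1 _ _ (neq _ _ _ _ _)).
pose mul (a : 'I_3) := (rt, a, a) :: rcons (nseq k (rt, rt, a)) (a, rt, a).
exists (machine M rx ry (mul rx) (mul ry)).
by apply: machine_decides => //; [|apply: multiplies_temp..]; apply: neq.
Qed.
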